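(* For all sufficiently large $n$, Maker has a winning strategy in the $k$-tournament game $\mathcal{T}(k,n)$ for $k = \lfloor 2\log_2 n - 2\log_2\log_2 n - 12\rfloor$, whichever tournament $T_k$ Breaker fixes. In other words, $k_t(n) \ge 2\log_2 n - 2\log_2\log_2 n - 12$.
   Context: The $k$-tournament game $\mathcal{T}(k,n)$ is played on the edge set of the complete graph $K_n$ by two players, Maker and Breaker. Before the game starts, Breaker fixes an arbitrary tournament $T_k$ on $k$ vertices; a tournament is a directed graph in which every pair of distinct vertices is joined by exactly one directed edge. Maker moves first, and the players then alternate. In each move the player claims one previously unclaimed edge of $K_n$ and chooses one of its two orientations. Maker wins if, at the end of the game (when all edges are claimed), the digraph formed by her oriented edges contains a copy of $T_k$; otherwise Breaker wins. $k_t(n)$ denotes the largest $k$ such that Maker has a winning strategy in $\mathcal{T}(k,n)$, i.e. for every choice of $T_k$ by Breaker. Logarithms are to base 2. *)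

(* Defs.v *)
From Stdlib Require Import Reals.
From mathcomp Require Import all_boot.
Set Implicit Arguments. Unset Strict Implicit. Unset Printing Implicit Defensive.

Definition log2R (x : R) : R := Rdiv (ln x) (ln (IZR 2%Z)).

Section Game.
Variable n : nat.

(* A move: claim the (unordered) edge {u,v} of K_n and orient it u -> v. *)
Definition move := ('I_n * 'I_n)%type.

(* A history is the sequence of moves played so far (Maker plays at even
   positions 0,2,4,..., Breaker at odd positions). *)
Definition history := seq move.

Definition strategy := history -> move.

Definition legal (h : history) (m : move) : bool :=
  [&& m.1 != m.2, m \notin h & (m.2, m.1) \notin h].

Fixpoint run (sM sB : strategy) (t : nat) : history :=
  match t with
  | 0 => [::]
  | t'.+1 => let h := run sM sB t' in
             rcons h ((if odd t' then sB else sM) h)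
  end.

Definition move_at (sM sB : strategy) (t : nat) : move :=
  (if odd t then sB else sM) (run sM sB t).

Definition maker_arcs (h : history) : seq move :=
  [seq x.2 | x <- zip (iota 0 (size h)) h & ~~ odd x.1].

Definition nedges : nat := 'C(n, 2).

End Game.

Definition is_tournament (k : nat) (T : rel 'I_k) : Prop :=
  (forall i, ~~ T i i) /\ (forall i j, i != j -> T i j != T j i).

Definition contains_copy (n k : nat) (A : seq (move n)) (T : rel 'I_k) : Prop :=
  exists f : 'I_k -> 'I_n, injective f /\
    forall i j, T i j -> (f i, f j) \in A.

(* Maker (strategy sM) wins against Breaker (strategy sB) with target T:
   either every move of the whole game is legal and Maker's final digraph
   contains a copy of T, or the first illegal move is made by Breaker
   (Breaker forfeits). *)
Definition maker_wins_against (n k : nat) (T : rel 'I_k)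
    (sM sB : strategy n) : Prop :=
  ((forall t, t < nedges n -> legal (run sM sB t) (move_at sM sB t)) /\
   contains_copy (maker_arcs (run sM sB (nedges n))) T)
  \/
  (exists t, [/\ t < nedges n, odd t,
     ~~ legal (run sM sB t) (move_at sM sB t) &
     forall s, s < t -> legal (run sM sB s) (move_at sM sB s)]).

Definition maker_wins (n k : nat) (T : rel 'I_k) : Prop :=
  exists sM : strategy n, forall sB : strategy n, maker_wins_against T sM sB.

(* Main.v *)
Require Import Defs.
From Stdlib Require Import Reals.
From Stdlib Require Lra.
From mathcomp Require Import all_boot order ssralg ssrnum.
From mathcomp Require Import ring lra zify.
From mathcomp Require Import Rstruct.
Import Order.TTheory GRing.Theory Num.Theory.
Set Implicit Arguments. Unset Strict Implicit. Unset Printing Implicit Defensive.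

(** Split the vertices into k parts of size m = n %/ k, the i-th one reserved
for the i-th vertex of T. Maker orients each edge between two parts according
to T, so it is enough that she claims every edge of some transversal k-clique:
the orientations play no further role.

Give a set of edges S the weight 2^-(number of unclaimed edges of S), or 0 if
Breaker owns an edge of S. Let t be the total weight of the transversal
cliques, and u the total weight of the unions of four transversal cliques that
agree on three common parts. Two distinct edges meet at least three parts, so
the weight of the cliques through both of them is at most u^(1/4). If Maker
always takes an edge maximizing the first-order change of log (t / u^(1/4)),
then t / u^(1/4) drops by at most 4/3 per round, and she wins as soon as its
initial value exceeds 4/3 times the number of rounds.

The initial value comes from a fourth-moment computation. If the four vertices
in part i take r_i distinct values and d_i = 4 - r_i, parts i and j span at
least 4 - min(d_i, d_j) distinct edges, so collapsing t parts besides the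
three common ones changes the weight by a factor at most
2^9 (2^((5+t)/2))^(sum of their d_i). The additive constant 12 makes
m^2 >= 2^(k+9), and then the sum over all collapsing patterns is at most k
times its trivial term. *)

(** * Potentials *)

Section Weight.
Variables (R : realFieldType) (E : finType).
Local Open Scope ring_scope.
Implicit Types (B M S : {set E}) (x y : E).

Definition weight M B S : R := [disjoint S & B]%:R * 2^-1 ^+ #|S :\: M|.

Lemma weight_ge0 M B S : 0 <= weight M B S.
Proof. by rewrite mulr_ge0 ?ler0n ?exprn_ge0 // invr_ge0 ler0n. Qed.

Lemma weight_gt0 M B S : (0 < weight M B S) = [disjoint S & B].
Proof.
rewrite /weight; case: [disjoint S & B]; last by rewrite mul0r ltxx.
by rewrite mul1r exprn_gt0 // invr_gt0 ltr0n.
Qed.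

Lemma weight_set0 M B : weight M B set0 = 1.
Proof. by rewrite /weight set0D cards0 expr0 mulr1 -setI_eq0 set0I eqxx. Qed.

(** Maker's edge [x] doubles the sets through it and Breaker's [y] kills those through it. Expanding
    the two factors makes [potential_round] an exact second-order formula. *)
Lemma weight_round x y M B S : x \notin M ->
  weight (x |: M) (y |: B) S =
  (1 + (x \in S)%:R) * (1 - (y \in S)%:R) * weight M B S.
Proof.
move=> xM.
have disj : [disjoint S & y |: B] = (y \notin S) && [disjoint S & B].
  by rewrite -!setI_eq0 setIUr setU_eq0 setI_eq0 disjoint_sym disjoints1.
have e : (2 : R)^-1 ^+ #|S :\: (x |: M)| * (2^-1) ^+ (x \in S) = 2^-1 ^+ #|S :\: M|.
  rewrite -exprD; congr (_ ^+ _).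
  by rewrite (cardsD1 x (S :\: M)) !inE xM /= setDDl setUC addnC.
rewrite /weight disj -e; case: (y \in S); case: (x \in S); case: [disjoint S & B];
  rewrite /= ?(mul0r, mul1r, subr0, subrr, mulr0, expr0, mulr1, expr1, addr0) //.
by rewrite -[1 + 1]/(2%:R) mulrCA mulfV ?mulr1 // pnatr_eq0.
Qed.

(** Both sides vanish in the same cases, and edges common to [S1] and [S2] are counted twice on the
    left but once on the right. *)
Lemma weight_setU M B S1 S2 :
  weight M B S1 * weight M B S2 <= weight M B (S1 :|: S2).
Proof.
have -> : weight M B (S1 :|: S2) =
   ([disjoint S1 & B]%:R * [disjoint S2 & B]%:R) * 2^-1 ^+ #|(S1 :|: S2) :\: M|.
  rewrite /weight -natrM mulnb -!setI_eq0 setIUl setU_eq0 //.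
rewrite /weight mulrACA -exprD ler_wpM2l ?mulr_ge0 //.
rewrite ler_wiXn2l ?invr_ge0 ?ler0n ?invf_le1 ?ler1n //.
by rewrite setDUl cardsU leq_subr.
Qed.

Lemma weight_bigcup M B (L : finType) (S : L -> {set E}) :
  \prod_l weight M B (S l) <= weight M B (\bigcup_l S l).
Proof.
suff /andP[] : 0 <= \prod_l weight M B (S l) <= weight M B (\bigcup_l S l) by [].
elim/big_ind2: _ => [|a S1 b S2 /andP[a0 a1] /andP[b0 b1]|l _].
- by rewrite weight_set0 ler01 lexx.
- rewrite mulr_ge0 //=; apply: le_trans (weight_setU _ _ _ _).
  exact: ler_pM.
- by rewrite weight_ge0 lexx.
Qed.

Section Potential.
Variables (I : finType) (F : I -> {set E}).

Definition potential M B : R := \sum_i weight M B (F i).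
Definition degree M B x : R := \sum_i (x \in F i)%:R * weight M B (F i).
Definition codegree M B x y : R :=
  \sum_i (x \in F i)%:R * (y \in F i)%:R * weight M B (F i).

Lemma potential_ge0 M B : 0 <= potential M B.
Proof. by apply: sumr_ge0 => i _; exact: weight_ge0. Qed.

Lemma codegree_ge0 M B x y : 0 <= codegree M B x y.
Proof.
by apply: sumr_ge0 => i _; rewrite mulr_ge0 ?weight_ge0 ?mulr_ge0 ?ler0n.
Qed.

Lemma potential_gt0P M B :
  reflect (exists i, [disjoint F i & B]) (0 < potential M B).
Proof.
apply: (iffP idP) => [T0|[i Fi]].
  apply/existsP; apply: contraTT T0 => /existsPn nF.
  rewrite -leNgt /potential big1 // => i _.
  by apply/eqP; rewrite eq_le weight_ge0 andbT leNgt weight_gt0.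
rewrite /potential (bigD1 i) //= ltr_pwDl ?weight_gt0 //.
by apply: sumr_ge0 => j _; exact: weight_ge0.
Qed.

Lemma potential_round x y M B : x \notin M ->
  potential (x |: M) (y |: B) =
  potential M B + degree M B x - degree M B y - codegree M B x y.
Proof.
move=> xM; rewrite /potential /degree /codegree -!sumrN -!big_split /=.
by apply: eq_bigr => i _; rewrite weight_round //; ring.
Qed.

End Potential.
End Weight.

(** * The change of the ratio of potentials in one round *)

Section Round.
Variable R : rcfType.
Local Open Scope ring_scope.

Definition root4 (u : R) := Num.sqrt (Num.sqrt u).

Lemma root4_ge0 u : 0 <= root4 u. Proof. exact: sqrtr_ge0. Qed.

Lemma root4K u : 0 <= u -> root4 u ^+ 4 = u.
Proof.
by move=> u0; rewrite (exprM _ 2 2) !sqr_sqrtr // sqrtr_ge0.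
Qed.

(** With [r = w' / w], the last hypothesis reads [t' >= t (3 + r^4) / 4 - c]. AM-GM gives
    [(3 + r^4) / 4 >= r], which serves the part [a - 4/3] of [a]; the remaining [4/3] yields
    [(3 + r^4) / 3 >= 1], which pays for [c <= w] even when [w'] vanishes. *)
Lemma fourth_root_drift (t t' w w' c a : R) :
  0 < w -> 0 <= w' -> c <= w -> 4 / 3 < a -> a * w <= t ->
  3 * w ^+ 4 * t + t * w' ^+ 4 - 4 * w ^+ 4 * c <= 4 * w ^+ 4 * t' ->
  0 < t' /\ (a - 4 / 3) * w' <= t'.
Proof.
move=> w0 w'0 cw a43 at_ ht.
have w40 : 0 < w ^+ 4 by rewrite exprn_gt0.
have w'40 : 0 <= w' ^+ 4 by rewrite exprn_ge0.
have t0 : 0 < t by apply: lt_le_trans at_; rewrite mulr_gt0 //; lra.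
have cw4 : 4 * w ^+ 4 * c <= 4 * w ^+ 4 * w by rewrite ler_wpM2l // mulr_ge0 // ltW.
have tw4 : 0 <= (3 * w ^+ 4 + w' ^+ 4) * (t - a * w).
  by rewrite mulr_ge0 ?subr_ge0 // addr_ge0 // mulr_ge0 // ltW.
have tw'4 : 0 <= t * w' ^+ 4 by rewrite mulr_ge0 // ltW.
(* 3 w^4 + w'^4 - 4 w^3 w' in factored form *)
have amgm : 0 <= w * (a - 4 / 3) * ((w - w') ^+ 2 * (3 * w ^+ 2 + 2 * (w * w') + w' ^+ 2)).
  apply: mulr_ge0; first by rewrite mulr_ge0 ?subr_ge0 // ltW.
  apply: mulr_ge0; first exact: sqr_ge0.
  have := mulr_ge0 (ltW w0) w'0; have := sqr_ge0 w; have := sqr_ge0 w'; lra.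
have ww' : 0 <= w * w' ^+ 4 by rewrite mulr_ge0 // ltW.
have aw5 : 0 < (a - 4 / 3) * w ^+ 5 by rewrite mulr_gt0 ?subr_gt0 ?exprn_gt0.
have tw5 : 0 <= w ^+ 4 * (t - a * w) by rewrite mulr_ge0 ?subr_ge0 // ltW.
have w4' : 0 < 4 * w ^+ 4 by rewrite mulr_gt0.
split.
- rewrite -(pmulr_rgt0 _ w4'); lra.
- rewrite -(ler_pM2l w4'); lra.
Qed.

Variables (E I J : finType) (F : I -> {set E}) (G : J -> {set E}).
Hypothesis F_gt1 : forall i, (1 < #|F i|)%N.
Hypothesis codegree_le : forall M B x y,
  x != y -> codegree R F M B x y ^+ 4 <= potential R G M B.

(* With t and u the potentials of F and G, this is 4 t u times the first-order
   change of log t - (log u) / 4. *)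
Definition gain M B x : R :=
  4 * potential R G M B * degree R F M B x - potential R F M B * degree R G M B x.

Lemma ratio_round a (M B : {set E}) x y : x \notin M -> x != y -> gain M B y <= gain M B x ->
  4 / 3 < a -> 0 < potential R F M B ->
  a * root4 (potential R G M B) <= potential R F M B ->
  0 < potential R F (x |: M) (y |: B) /\
  (a - 4 / 3) * root4 (potential R G (x |: M) (y |: B))
    <= potential R F (x |: M) (y |: B).
Proof.
move=> xM xy; rewrite /gain => gxy a43 T0 aT.
set U := potential R G M B in gxy aT *; set T := potential R F M B in gxy T0 aT *.
(* A surviving [F i] contains two distinct edges and contributes to their codegree, which
   [codegree_le] compares with [U]. *)
have U0 : 0 < U.
  have /potential_gt0P[i Fi] := T0.
  have /card_gt1P[u [v [uF vF uv]]] := F_gt1 i.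
  apply: lt_le_trans (codegree_le M B uv); apply: exprn_gt0.
  rewrite /codegree (bigD1 i) //= uF vF !mul1r ltr_pwDl ?weight_gt0 //.
  by apply: sumr_ge0 => j _; rewrite mulr_ge0 ?weight_ge0 ?mulr_ge0 ?ler0n.
have U'0 : 0 <= potential R G (x |: M) (y |: B) by exact: potential_ge0.
have w4 := root4K (ltW U0); have w'4 := root4K U'0.
have w0 : 0 < root4 U.
  rewrite lt0r root4_ge0 andbT; apply: contraTneq U0 => w0.
  by rewrite -w4 w0 expr0n ltxx.
apply: (fourth_root_drift (t := T) (w := root4 U) (c := codegree R F M B x y)) => //.
- exact: root4_ge0.
- by rewrite -(ler_pXn2r (_ : 0 < 4)%N) ?nnegrE ?codegree_ge0 ?root4_ge0 // w4 codegree_le.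
(* The second-order term of [G] has a favourable sign and is dropped; that of [F] is the loss
   [c]. *)
- have hc : 0 <= T * codegree R G M B x y by rewrite mulr_ge0 ?codegree_ge0 // ltW.
  rewrite w'4 w4 !potential_round // -/U -/T; lra.
Qed.

End Round.

(** * The greedy strategy *)

Section Play.
Variable n : nat.
Implicit Types (m x e : move n) (h : history n).

(* The undirected edge {u, v} is represented by the pair (u, v) with u < v. *)
Definition edge_of m : move n := if m.1 < m.2 then m else (m.2, m.1).
Definition edges : {set move n} := [set e : move n | e.1 < e.2].
Definition claimed h : {set move n} := [set edge_of x | x in h].
Definition maker_edges h : {set move n} := [set edge_of x | x in maker_arcs h].
Definition breaker_edges h : {set move n} := claimed h :\: maker_edges h.
Definition free h e : bool := (e \in edges) && (e \notin claimed h).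

Lemma card_edges : #|edges| = nedges n.
Proof.
rewrite /nedges -bin2_sum -sum1_card.
under eq_bigl => e do rewrite inE.
rewrite -(pair_big_dep xpredT (fun u v : 'I_n => u < v) (fun _ _ => 1)) /=.
rewrite (exchange_big_dep xpredT) //= big_mkord; apply: eq_bigr => v _.
rewrite sum1_card -[RHS](card_ord v).
have winj : injective (widen_ord (ltnW (ltn_ord v))).
  by move=> u w /(congr1 val) uw; apply: val_inj.
rewrite -(card_image winj).
apply: eq_card => u; apply/idP/imageP => [uv|[w _ ->]]; last exact: (ltn_ord w).
by exists (Ordinal uv) => //; apply: val_inj.
Qed.

Lemma edge_of_in_edges m : (edge_of m \in edges) = (m.1 != m.2).
Proof.
case: m => u v; rewrite inE /edge_of /=.
by rewrite -val_eqE /=; case: (ltngtP u v) => //= ->; rewrite ltnn.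
Qed.

Lemma edge_of_eq m x : (edge_of m == edge_of x) = (m == x) || ((m.2, m.1) == x).
Proof.
case: m x => [u v] [u' v']; rewrite /edge_of /=.
rewrite !(fun_if (fun z => z == _)) !(fun_if (fun z => _ == z)) !xpair_eqE /=.
by case: (ltngtP u v); case: (ltngtP u' v'); rewrite -!val_eqE /=; lia.
Qed.

Lemma legalE h m : legal h m = free h (edge_of m).
Proof.
rewrite /legal /free edge_of_in_edges; congr (_ && _).
rewrite -negb_or; congr (~~ _); apply/orP/imsetP => [|[x xh /eqP]].
  case=> mh; [by exists m | exists (m.2, m.1) => //].
  by apply/eqP; rewrite edge_of_eq eqxx orbT.
by rewrite edge_of_eq => /orP[]/eqP->; [left | right].
Qed.

Lemma claimed_rcons h m : claimed (rcons h m) = edge_of m |: claimed h.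
Proof.
apply/setP => e; rewrite !inE; apply/imsetP/orP => [[x]|[/eqP->|/imsetP[x xh ->]]].
- rewrite mem_rcons inE => /orP[/eqP->->|xh ->]; first by left.
  by right; apply: imset_f.
- by exists m => //; rewrite mem_rcons inE eqxx.
- by exists x => //; rewrite mem_rcons inE xh orbT.
Qed.

Lemma maker_arcs_rcons h m :
  maker_arcs (rcons h m) = if odd (size h) then maker_arcs h else rcons (maker_arcs h) m.
Proof.
rewrite /maker_arcs size_rcons -addn1 iotaD -cats1 zip_cat ?size_iota //=.
rewrite filter_cat map_cat /= add0n; case: odd => /=; first by rewrite cats0.
by rewrite cats1.
Qed.

Lemma maker_edges_rcons h m :
  maker_edges (rcons h m) =
  if odd (size h) then maker_edges h else edge_of m |: maker_edges h.
Proof.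
rewrite /maker_edges maker_arcs_rcons; case: ifP => // _.
exact: (claimed_rcons (maker_arcs h)).
Qed.

Lemma maker_edges_sub h : maker_edges h \subset claimed h.
Proof.
apply/subsetP => _ /imsetP[x /mapP[[i y] iy xy] ->]; apply: imset_f.
move: iy; rewrite mem_filter xy => /andP[_ iy].
by have := map_f snd iy; rewrite -/unzip2 unzip2_zip ?size_iota.
Qed.

Lemma breaker_edges_rcons h m : free h (edge_of m) ->
  breaker_edges (rcons h m) =
  if odd (size h) then edge_of m |: breaker_edges h else breaker_edges h.
Proof.
case/andP=> _ mh; rewrite /breaker_edges claimed_rcons maker_edges_rcons.
have mM : edge_of m \notin maker_edges h.
  by apply: contra mh; apply/subsetP/maker_edges_sub.
apply/setP => e; case: ifP => _; rewrite !inE;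
  by case: eqP => [->|] //=; rewrite ?(negPf mh) ?(negPf mM) ?andbF.
Qed.

Lemma free_rcons h m e : free (rcons h m) e = (e != edge_of m) && free h e.
Proof. by rewrite /free claimed_rcons !inE negb_or andbCA. Qed.

Lemma size_run (sM sB : strategy n) t : size (run sM sB t) = t.
Proof. by elim: t => //= t IH; rewrite size_rcons IH. Qed.

Lemma runS (sM sB : strategy n) t :
  run sM sB t.+1 = rcons (run sM sB t) (move_at sM sB t).
Proof. by []. Qed.

Lemma claimed_run (sM sB : strategy n) t :
  (forall s, s < t -> legal (run sM sB s) (move_at sM sB s)) ->
  #|claimed (run sM sB t)| = t /\ claimed (run sM sB t) \subset edges.
Proof.
elim: t => [_|t IH leg].
  have -> : claimed (run sM sB 0) = set0 by apply/setP=> e; rewrite inE; apply/imsetP => -[].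
  by rewrite cards0 sub0set.
have [ct se] := IH (fun s st => leg s (ltnW st)).
have := leg t (ltnSn t); rewrite legalE => /andP[mE mc].
by rewrite runS claimed_rcons cardsU1 mc ct subUset sub1set mE se.
Qed.

Variables (R : rcfType) (I J : finType) (F : I -> {set move n}) (G : J -> {set move n}).
Hypothesis F_edges : forall i, F i \subset edges.
Hypothesis F_gt1 : forall i, (1 < #|F i|).
Hypothesis codegree_le : forall M B x y, x != y ->
  (codegree R F M B x y ^+ 4 <= potential R G M B)%R.
Hypothesis F_nonempty : (0 < potential R F set0 set0)%R.
Hypothesis initial_ratio :
  (4 / 3 * (nedges n).+1%:R * root4 (potential R G set0 set0)
    <= potential R F set0 set0)%R.

Variable orient : move n -> move n.
Hypothesis edge_of_orient : forall e, e \in edges -> edge_of (orient e) = e.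

Definition greedy_edge h (e0 : move n) : move n :=
  [arg max_(e > e0 | free h e) gain R F G (maker_edges h) (breaker_edges h) e]%O.

Definition greedy (x0 : move n) : strategy n := fun h =>
  if [pick e | free h e] is Some e0 then orient (greedy_edge h e0) else x0.

Lemma greedyP x0 h : (exists e, free h e) ->
  exists e, [/\ free h e, greedy x0 h = orient e &
    forall e', free h e' ->
     (gain R F G (maker_edges h) (breaker_edges h) e' <=
      gain R F G (maker_edges h) (breaker_edges h) e)%R].
Proof.
move=> [e1 fe1]; rewrite /greedy; case: pickP => [e0 fe0|/(_ e1)]; last by rewrite fe1.
rewrite /greedy_edge; case: arg_maxP => // e fe emax; by exists e.
Qed.

Section AgainstBreaker.
Variables (x0 : move n) (sB : strategy n).
Notation play := (run (greedy x0) sB).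
Notation legal_until t :=
  (forall s, s < t -> legal (play s) (move_at (greedy x0) sB s)).

Lemma greedy_move t : t < nedges n -> legal_until t -> ~~ odd t ->
  exists e, [/\ free (play t) e, move_at (greedy x0) sB t = orient e &
    forall e', free (play t) e' ->
     (gain R F G (maker_edges (play t)) (breaker_edges (play t)) e' <=
      gain R F G (maker_edges (play t)) (breaker_edges (play t)) e)%R].
Proof.
move=> tn leg todd; rewrite /move_at (negPf todd); apply: greedyP.
have [ct se] := claimed_run leg.
have /set0Pn[e] : edges :\: claimed (play t) != set0.
  by rewrite -card_gt0 cardsD (setIidPr se) ct card_edges subn_gt0.
by rewrite inE => /andP[ec eE]; exists e; rewrite /free eE.
Qed.

Lemma greedy_legal t : t < nedges n -> legal_until t -> ~~ odd t ->
  legal (play t) (move_at (greedy x0) sB t).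
Proof.
move=> tn leg todd; have [e [fe -> _]] := greedy_move tn leg todd.
by rewrite legalE edge_of_orient //; case/andP: fe.
Qed.

(** Each full round costs [4/3] by [ratio_round]: Breaker's legal reply was itself free when Maker
    chose an edge of maximal [gain]. *)
Lemma ratio_run i : i.*2 <= nedges n -> legal_until (nedges n) ->
  let M := maker_edges (play i.*2) in
  let B := breaker_edges (play i.*2) in
  (0 < potential R F M B /\
   4 / 3 * ((nedges n).+1%:R - i%:R) * root4 (potential R G M B) <= potential R F M B)%R.
Proof.
move=> + leg; elim: i => [_|i IH iN].
  have M0 : maker_edges (play 0.*2) = set0.
    by apply/setP => e; rewrite inE; apply/imsetP => -[].
  have C0 : claimed (play 0.*2) = set0.
    by apply/setP => e; rewrite inE; apply/imsetP => -[].
  by rewrite /breaker_edges C0 M0 setD0 subr0.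
have iN1 : i.*2.+1 < nedges n by rewrite -doubleS.
have iN0 := ltnW iN1.
have [T0 aT] := IH (ltnW iN0).
have legM := leg _ iN0; have legB := leg _ iN1.
have leg_until : legal_until i.*2 by move=> s si; apply: leg; apply: ltn_trans iN0.
have [|e [fe eM emax]] := greedy_move iN0 leg_until; first by rewrite odd_double.
set x := move_at _ _ _ in eM legM; set y := move_at _ _ _ in legB.
have eE : e \in edges by case/andP: fe.
have xe : edge_of x = e by rewrite eM edge_of_orient.
rewrite legalE runS -/x free_rcons xe in legB.
have /andP[ye fy] := legB.
rewrite doubleS !runS -/x -/y.
rewrite breaker_edges_rcons; last by rewrite free_rcons xe legB.
rewrite breaker_edges_rcons ?xe // !maker_edges_rcons !size_rcons size_run /= odd_double /= xe.
have -> : ((nedges n).+1%:R - i.+1%:R = (nedges n).+1%:R - i%:R - 1 :> R)%R.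
  by rewrite -(natr1 i) opprD addrA.
rewrite mulrBr mulr1; apply: ratio_round => //.
- case/andP: fe => _; apply: contra; exact/subsetP/maker_edges_sub.
- by rewrite eq_sym.
- exact: emax.
(* The coefficient before the round exceeds [4/3] because [i < nedges n]; the extra one in
   [(nedges n).+1] enters here. *)
- rewrite -[X in (X < _)%R]mulr1 ltr_pM2l ?divr_gt0 ?ltr0n //.
  have iN' : i < nedges n by apply: leq_ltn_trans iN0; rewrite -addnn leq_addr.
  by rewrite -natrB ?ltr1n ?ltn_subRL ?addn1 // ltnW // ltnW.
Qed.

(** Sets of edges forget directions. An arc is recovered from its edge because Maker always plays
    [orient] of the edge she takes. *)
Lemma maker_arcs_orient t x : t <= nedges n -> legal_until (nedges n) ->
  x \in maker_arcs (play t) -> x = orient (edge_of x).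
Proof.
move=> + leg; elim: t => [//|t IH tn].
rewrite runS maker_arcs_rcons size_run; case: ifPn => todd; first exact/IH/ltnW.
rewrite mem_rcons inE => /orP[/eqP->|]; last exact/IH/ltnW.
have [|e [fe -> _]] := greedy_move tn _ todd.
  by move=> s st; apply: leg; apply: ltn_trans tn.
by rewrite edge_of_orient //; case/andP: fe.
Qed.

(** A positive final potential means that some [F i] avoids Breaker's edges; the board is full, so
    Maker owns all of it. *)
Lemma greedy_claims : legal_until (nedges n) ->
  exists i, forall e, e \in F i -> orient e \in maker_arcs (play (nedges n)).
Proof.
move=> leg; set N := nedges n.
have [cN sN] := claimed_run leg.
have cE : claimed (play N) = edges.
  by apply/eqP; rewrite eqEcard sN card_edges cN leqnn.
(* If the number of edges is odd, the last move is Maker's, so Breaker's edges are those after the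
   last full round. *)
have bE : breaker_edges (play N) = breaker_edges (play N./2.*2).
  rewrite -{1}[N]odd_double_half; case: (boolP (odd N)) => [oN|_]; last by [].
  rewrite add1n runS breaker_edges_rcons ?size_run ?odd_double //.
  rewrite -legalE; apply: leg; rewrite -/N; lia.
have [|/potential_gt0P[i Fi] _] := @ratio_run N./2 _ leg; first by rewrite -/N; lia.
exists i => e eF.
have : e \in maker_edges (play N).
  apply: contraLR Fi => eM; rewrite -bE; apply/pred0Pn; exists e => /=.
  by rewrite eF /breaker_edges inE eM cE; apply: subsetP eF.
case/imsetP => x xN ex; by rewrite ex -(maker_arcs_orient _ leg xN).
Qed.

(** Maker's move is legal as long as all earlier moves were, so a first illegal move can only occur
    at an odd time. *)
Lemma greedy_wins :
  (legal_until (nedges n) /\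
   exists i, forall e, e \in F i -> orient e \in maker_arcs (play (nedges n))) \/
  (exists t, [/\ t < nedges n, odd t,
     ~~ legal (play t) (move_at (greedy x0) sB t) & legal_until t]).
Proof.
case: (boolP [forall t : 'I_(nedges n), legal (play t) (move_at (greedy x0) sB t)]).
  move=> /forallP leg; have leg' : legal_until (nedges n).
    by move=> t tn; exact: (leg (Ordinal tn)).
  by left; split => //; exact: greedy_claims.
rewrite negb_forall => /existsP[t0 it0]; right.
have ex : exists t, (t < nedges n) && ~~ legal (play t) (move_at (greedy x0) sB t).
  by exists t0; rewrite ltn_ord.
case: (ex_minnP ex) => t /andP[tn it] tmin.
have leg : legal_until t.
  move=> s st; apply/negPn/negP => si.
  by have := tmin s; rewrite si (ltn_trans st tn) leqNgt st => /(_ isT).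
exists t; split => //; apply: contraR it => todd; exact: greedy_legal.
Qed.

End AgainstBreaker.
End Play.

(** * Transversal cliques *)

Section Rank.
Variable T : finType.

Definition rank p (t : p.-tuple T) : nat := #|[set x in t]|.

Lemma rank_le p (t : p.-tuple T) : rank t <= p.
Proof. by rewrite /rank cardsE (leq_trans (card_size t)) ?size_tuple. Qed.

Lemma rank_imset p (t : p.-tuple T) : rank t = #|[set tnth t l | l : 'I_p]|.
Proof.
congr #|pred_of_set _|; apply/setP => x; rewrite inE; apply/idP/imsetP => [/tnthP[l ->]|[l _ ->]].
  by exists l.
exact: mem_tnth.
Qed.

Lemma rank_gt0 p (t : p.+1.-tuple T) : 0 < rank t.
Proof. by rewrite card_gt0; apply/set0Pn; exists (thead t); rewrite inE mem_tnth. Qed.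

Lemma rank_cons p (x : T) (t : p.-tuple T) : rank [tuple of x :: t] = (x \notin t) + rank t.
Proof. by rewrite /rank set_cons cardsU1 inE. Qed.

Lemma rank_eq1P p (t : p.+1.-tuple T) :
  reflect (exists c, t = [tuple of nseq p.+1 c]) (rank t == 1).
Proof.
apply: (iffP cards1P) => -[c tc]; exists c.
  apply/eq_from_tnth => l; rewrite tnth_nseq.
  by apply/set1P; rewrite -tc inE mem_tnth.
by apply/setP => x; rewrite tc in_set in_set1 [LHS]mem_nseq.
Qed.

Lemma card_rank1 p : #|[pred t : p.+1.-tuple T | rank t == 1]| <= #|T|.
Proof.
apply: leq_trans (leq_imset_card (fun c => [tuple of nseq p.+1 c]) T).
apply: subset_leq_card; apply/subsetP => t /rank_eq1P[c ->].
exact: imset_f.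
Qed.

End Rank.

Section Cliques.
Variables (n k m : nat) (vert : 'I_k -> 'I_m -> 'I_n).
Hypothesis vert_lt : forall (i j : 'I_k) a b, i < j -> vert i a < vert j b.
Hypothesis vert_inj : forall i, injective (vert i).

Lemma vert_eq i j a b : (vert i a == vert j b) = (i == j) && (a == b).
Proof.
case: (ltngtP i j) => [ij|ij|/val_inj <-].
- by rewrite -val_eqE (ltn_eqF (vert_lt a b ij)) -val_eqE (ltn_eqF ij).
- by rewrite -val_eqE (gtn_eqF (vert_lt b a ij)) -val_eqE (gtn_eqF ij).
- by rewrite eqxx (inj_eq (@vert_inj i)).
Qed.

(** By [vert_lt], a pair [p] in [edges k] gives an edge already in normal form. *)
Definition edge_between (p : move k) (a b : 'I_m) : move n := (vert p.1 a, vert p.2 b).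

Lemma edge_between_eq p q a b a' b' :
  (edge_between p a b == edge_between q a' b') = [&& p == q, a == a' & b == b'].
Proof.
rewrite xpair_eqE !vert_eq; case: p q => [i j] [i' j'].
by rewrite /= xpair_eqE andbACA andbA.
Qed.

Definition clique (f : {ffun 'I_k -> 'I_m}) : {set move n} :=
  [set edge_between p (f p.1) (f p.2) | p in edges k].

Lemma clique_edges f : clique f \subset edges n.
Proof.
by apply/subsetP => _ /imsetP[p pE ->]; rewrite inE vert_lt //; rewrite inE in pE.
Qed.

Lemma card_clique f : #|clique f| = nedges k.
Proof.
rewrite card_imset ?card_edges // => p q /eqP.
by rewrite edge_between_eq => /and3P[/eqP].
Qed.

Lemma mem_clique p a b f : p \in edges k ->
  (edge_between p a b \in clique f) = (f p.1 == a) && (f p.2 == b).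
Proof.
move=> pE; apply/imsetP/andP => [[q _ /eqP]|[/eqP<- /eqP<-]]; last by exists p.
by rewrite edge_between_eq => /and3P[/eqP-> /eqP-> /eqP->].
Qed.

Notation quads := {ffun 'I_k -> 4.-tuple 'I_m}.

(** Four cliques are stored transposed, as one 4-tuple of vertices per part, so that sums over
    quadruples factor over the parts. *)
Definition slice (b : quads) l : {ffun 'I_k -> 'I_m} := [ffun i => tnth (b i) l].
Definition bundle (b : quads) : {set move n} := \bigcup_(l < 4) clique (slice b l).

(** Between two parts, the four cliques use at least as many edges as they have distinct endpoints
    on either side, and different pairs of parts give different edges. *)
Lemma card_bundle (b : quads) :
  \sum_(p in edges k) maxn (rank (b p.1)) (rank (b p.2)) <= #|bundle b|.
Proof.
pose fan (p : move k) := [set edge_between p (tnth (b p.1) l) (tnth (b p.2) l) | l : 'I_4].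
have fan_card p : maxn (rank (b p.1)) (rank (b p.2)) <= #|fan p|.
  rewrite geq_max !rank_imset; apply/andP; split.
    rewrite -(card_imset _ (@vert_inj p.1)) -imset_comp.
    have -> : [set (vert p.1 \o tnth (b p.1)) l | l : 'I_4] = [set x.1 | x in fan p].
      by rewrite /fan -imset_comp; apply: eq_imset.
    exact: leq_imset_card.
  rewrite -(card_imset _ (@vert_inj p.2)) -imset_comp.
  have -> : [set (vert p.2 \o tnth (b p.2)) l | l : 'I_4] = [set x.2 | x in fan p].
    by rewrite /fan -imset_comp; apply: eq_imset.
  exact: leq_imset_card.
have part x p : x \in fan p -> forall q, x \in fan q -> p = q.
  move=> /imsetP[l _ ->] q /imsetP[l' _ /eqP].
  by rewrite edge_between_eq => /and3P[/eqP].
have bundleE : bundle b = \bigcup_(p in edges k) fan p.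
  apply/setP => x; apply/bigcupP/bigcupP => [[l _ /imsetP[p pE ->]]|[p pE /imsetP[l _ ->]]].
    by exists p => //; apply/imsetP; exists l => //; rewrite !ffunE.
  by exists l => //; apply/imsetP; exists p => //; rewrite !ffunE.
rewrite bundleE; apply: (@leq_trans (\sum_(p in edges k) #|fan p|)).
  by apply: leq_sum => p _; exact: fan_card.
apply: eq_leq.
rewrite (eq_bigr (fun p => \sum_(x in \bigcup_(p in edges k) fan p) (x \in fan p : nat))); last first.
  move=> p pE; rewrite -big_mkcondr /= -sum1_card; apply: eq_bigl => x.
  by apply/idP/andP => [xp|[]//]; split => //; apply/bigcupP; exists p.
rewrite exchange_big /= -sum1_card; apply: eq_bigr => x /bigcupP[p pE xp].
rewrite (bigD1 p) //= xp big1 // => q /andP[qE qp].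
by case: (boolP (x \in fan q)) => // xq; rewrite (part _ _ xp _ xq) eqxx in qp.
Qed.

(* The four slices of b agree on the three parts in Q. *)
Definition agreeing : {pred {set 'I_k} * quads} :=
  [pred Qb : {set 'I_k} * quads | (#|Qb.1| == 3) && [forall i in Qb.1, rank (Qb.2 i) == 1]].

Definition bundle_of (z : {x | x \in agreeing}) : {set move n} := bundle (val z).2.

Variable R : rcfType.
Local Open Scope ring_scope.

Lemma potential_bundle M B :
  potential R bundle_of M B =
  \sum_(Q : {set 'I_k} | #|Q| == 3%N)
    \sum_(b : quads | [forall i in Q, rank (b i) == 1%N]) weight R M B (bundle b).
Proof.
rewrite /potential -(big_sub _ (fun z => weight R M B (bundle z.2))).
by rewrite pair_big_dep /=; apply: eq_bigl => z.
Qed.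

Definition joint (g : {ffun 'I_4 -> {ffun 'I_k -> 'I_m}}) : quads :=
  [ffun i => [tuple g l i | l < 4]].

Lemma joint_inj : injective joint.
Proof.
move=> g h gh; apply/ffunP => l; apply/ffunP => i.
have := congr1 (fun b : quads => tnth (b i) l) gh.
by rewrite !ffunE !tnth_mktuple.
Qed.

Lemma bundle_joint g : bundle (joint g) = \bigcup_l clique (g l).
Proof.
apply: eq_bigr => l _; congr clique; apply/ffunP => i.
by rewrite !ffunE tnth_mktuple.
Qed.

Lemma three_parts p q : p \in edges k -> q \in edges k -> p != q ->
  exists2 Q : {set 'I_k}, #|Q| = 3%N &
    {subset Q <= [:: p.1; p.2; q.1; q.2]}.
Proof.
rewrite !inE => p12 q12 pq.
(* An increasing pair other than [p] has an endpoint outside [p]; [c] is such an endpoint of [q]. *)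
pose c := if q.1 \in [set p.1; p.2] then q.2 else q.1.
exists (c |: [set p.1; p.2]).
  rewrite cardsU1 cards2 -val_eqE (ltn_eqF p12) /= /c.
  suff -> : (if q.1 \in [set p.1; p.2] then q.2 else q.1) \notin [set p.1; p.2] by [].
  case: ifP => [|->//]; rewrite !inE; move: pq; rewrite -pair_eqE /pair_eq.
  by rewrite -!val_eqE /=; move: p12 q12; lia.
move=> i; rewrite /c !inE => /orP[/eqP->|/orP[/eqP->|/eqP->]]; rewrite ?eqxx ?orbT //.
by case: ifP; rewrite eqxx ?orbT.
Qed.

(** All cliques through [x] and [y] agree on three common parts. The fourth power of their total
    weight expands into quadruples, each bounded through [weight_bigcup] by the weight of its union,
    a term of the potential of [bundle_of]. *)
Lemma codegree_clique_le M B x y : x != y ->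
  codegree R clique M B x y ^+ 4 <= potential R bundle_of M B.
Proof.
(* If no clique contains both edges, as when they join the same two parts, the codegree is zero.
   Otherwise [f0] supplies the common values on [Q]. *)
move=> xy; case: (pickP [pred f | (x \in clique f) && (y \in clique f)]) => [f0|none]; last first.
  rewrite /codegree big1 ?expr0n ?potential_ge0 // => f _.
  by have /= := none f; do 2?case: (_ \in _); rewrite // ?mul0r ?mulr0 ?mul0r.
case/andP => /imsetP[p pE xp] /imsetP[q qE yq].
have pq : p != q by apply: contraNneq xy => pq; rewrite xp yq pq.
have [Q Q3 sQ] := three_parts pE qE pq.
pose agr (f : {ffun 'I_k -> 'I_m}) := [forall i in Q, f i == f0 i].
have le1 : codegree R clique M B x y <= \sum_(f | agr f) weight R M B (clique f).
  rewrite /codegree [leRHS]big_mkcond; apply: ler_sum => f _.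
  case: (boolP (x \in clique f)) => [xf|_]; last first.
    by rewrite !mul0r; case: ifP => _; rewrite ?weight_ge0.
  case: (boolP (y \in clique f)) => [yf|_]; last first.
    by rewrite mulr0 mul0r; case: ifP => _; rewrite ?weight_ge0.
  rewrite !mul1r ifT //; apply/forall_inP => i /sQ.
  move: xf yf; rewrite xp yq !mem_clique // => /andP[/eqP p1 /eqP p2] /andP[/eqP q1 /eqP q2].
  by rewrite !inE => /or4P[]/eqP->; apply/eqP.
apply: le_trans (_ : (\sum_(f | agr f) weight R M B (clique f)) ^+ 4 <= _).
  by rewrite lerXn2r ?nnegrE ?codegree_ge0 ?sumr_ge0 // => f _; exact: weight_ge0.
rewrite -[X in _ ^+ X](card_ord 4) -prodr_const bigA_distr_big /=.
rewrite potential_bundle (bigD1 Q) ?Q3 //=.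
apply: le_trans (_ : \sum_(g in ffun_on agr) weight R M B (bundle (joint g)) <= _).
  by apply: ler_sum => g _; rewrite bundle_joint; exact: weight_bigcup.
rewrite -[leLHS]addr0 lerD //; last first.
  by apply: sumr_ge0 => ? _; apply: sumr_ge0 => ? _; exact: weight_ge0.
rewrite -(big_imset (fun b => weight R M B (bundle b))) /=; last by move=> ? ? _ _; exact: joint_inj.
rewrite [leRHS]big_mkcond [leLHS]big_mkcond; apply: ler_sum => b _.
case: ifP => [/imsetP[g /ffun_onP gA ->]|_]; last by case: ifP => _; rewrite ?weight_ge0.
rewrite ifT //; apply/forall_inP => i iQ; apply/rank_eq1P; exists (f0 i).
rewrite ffunE; apply: eq_from_tnth => l; rewrite tnth_mktuple tnth_nseq.
by have /forall_inP/(_ i iQ)/eqP := gA l.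
Qed.

End Cliques.

(** * The initial potentials *)

Lemma double_sum_edges k (F : 'I_k -> 'I_k -> nat) : (forall i j, F i j = F j i) ->
  2 * \sum_(p in edges k) F p.1 p.2 = \sum_i \sum_(j | j != i) F i j.
Proof.
move=> Fsym.
have -> : \sum_(p in edges k) F p.1 p.2 = \sum_(i : 'I_k) \sum_(j : 'I_k | i < j) F i j.
  by rewrite pair_big_dep /=; apply: eq_bigl => p; rewrite inE.
rewrite mul2n -addnn {2}(exchange_big_dep xpredT) //= -big_split /=.
apply: eq_bigr => i _; rewrite [RHS](bigID (fun j : 'I_k => i < j)) /=; congr (_ + _).
  by apply: eq_bigl => j; rewrite -val_eqE /=; case: ltngtP.
under eq_bigr => j _ do rewrite Fsym.
by apply: eq_bigl => j; rewrite -val_eqE /=; case: ltngtP.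
Qed.

(** In the symmetric double sum, rows in [Q] give at most [3 * (6 + D)]. Rows outside give at most
    [3 * D] against [Q] and [#|Z| * D - D] among themselves. *)
Lemma sum_minn_edges_le k (d : 'I_k -> nat) (Q : {set 'I_k}) :
  #|Q| = 3 -> (forall i, d i <= 3) ->
  2 * \sum_(p in edges k) minn (d p.1) (d p.2) <=
  18 + (5 + #|[set i in ~: Q | 0 < d i]|) * \sum_(i in ~: Q) d i.
Proof.
move=> Q3 d3; rewrite (double_sum_edges (F := fun i j => minn (d i) (d j))); last first.
  by move=> i j; rewrite minnC.
set Z := [set i in ~: Q | 0 < d i]; set D := \sum_(i in ~: Q) d i.
have inQ i : i \in Q -> \sum_(j | j != i) minn (d i) (d j) <= 6 + D.
  move=> iQ; rewrite (bigID (mem Q)) /= leq_add //.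
    have <- : \sum_(j | (j != i) && (j \in Q)) 3 = 6.
      rewrite sum_nat_const (_ : #|_| = 2) //.
      have := cardsD1 i Q; rewrite iQ Q3 => -[->].
      by apply: eq_card => j; rewrite !inE.
    by apply: leq_sum => j _; rewrite geq_min d3.
  rewrite /D [leqRHS]big_mkcond [leqLHS]big_mkcond; apply: leq_sum => j _.
  by rewrite inE; case: ifP => [/andP[_ ->]|_] //; rewrite geq_minr.
have outQ i : i \in ~: Q -> \sum_(j | j != i) minn (d i) (d j) <=
   3 * d i + \sum_(j in ~: Q | j != i) minn (d i) (d j).
  move=> iQ; rewrite (bigID (mem Q)) /= leq_add //; last first.
    by apply: eq_leq; apply: eq_bigl => j; rewrite inE andbC.
  rewrite -Q3 -sum_nat_const [leqRHS]big_mkcond [leqLHS]big_mkcond.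
  by apply: leq_sum => j _; case: ifP => [/andP[_ ->]|_] //; rewrite geq_minl.
rewrite (bigID (mem Q)) /=.
have -> : \sum_(i | i \notin Q) \sum_(j | j != i) minn (d i) (d j) =
          \sum_(i in ~: Q) \sum_(j | j != i) minn (d i) (d j).
  by apply: eq_bigl => i; rewrite inE.
have le1 : \sum_(i in Q) \sum_(j | j != i) minn (d i) (d j) <= 3 * (6 + D).
  by rewrite -{1}Q3 -sum_nat_const; apply: leq_sum => i; exact: inQ.
have := @leq_sum _ (index_enum _) _ _ _ outQ.
rewrite big_split /= -big_distrr /= -/D => le2.
set B := \sum_(i in ~: Q) \sum_(j in ~: Q | j != i) minn (d i) (d j) in le2.
suff BD : B + D <= #|Z| * D.
  apply: leq_trans (leq_add le1 le2) _; rewrite mulnDl; move: BD.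
  by move: (#|Z| * D) => x; clear; lia.
(* The bound used is [2 * minn a b <= a * (0 < b) + b * (0 < a)]; each [i] in [Z] then meets the
   [#|Z| - 1] other members of [Z]. *)
pose C := \sum_(i in ~: Q) \sum_(j in ~: Q | j != i) d i * (0 < d j).
have BC : 2 * B <= C + C.
  rewrite {2}/C (exchange_big_dep (mem (~: Q))) //=; last by move=> i j _ /andP[].
  rewrite /B /C big_distrr /= -big_split /=; apply: leq_sum => i iQ.
  have -> : \sum_(i0 in ~: Q | (i \in ~: Q) && (i != i0)) d i0 * (0 < d i) =
            \sum_(j in ~: Q | j != i) d j * (0 < d i).
    by apply: eq_bigl => j; rewrite iQ eq_sym.
  rewrite big_distrr /= -big_split /=; apply: leq_sum => j _.
  by case: (d i) => [|a]; case: (d j) => [|b] /=; lia.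
have CD : C + D <= #|Z| * D.
  rewrite /C /D big_distrr -big_split /=; apply: leq_sum => i iQ.
  rewrite -big_distrr /=; case: (posnP (d i)) => [->|di]; first by rewrite mul0n muln0.
  rewrite -{2}[d i]muln1 -mulnDr mulnC leq_mul2r; apply/orP; right.
  rewrite -sum1_card [leqRHS](bigD1 i) /=; last by rewrite inE iQ.
  rewrite addnC leq_add2l big_mkcond [leqRHS]big_mkcond; apply: leq_sum => j _.
  rewrite [j \in Z]inE; case: (j \in ~: Q); case: (j != i); case: (0 < d j) => //.
by move: BC CD; lia.
Qed.

(** * Counting tuples by their repetitions, and a binomial estimate *)

Section Estimates.
Variable R : rcfType.
Local Open Scope ring_scope.

Lemma big_cons_tuple (T : finType) p (f : p.+1.-tuple T -> R) :
  \sum_t f t = \sum_x \sum_(t : p.-tuple T) f [tuple of x :: t].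
Proof.
rewrite pair_bigA /= (reindex (fun z : T * p.-tuple T => [tuple of z.1 :: z.2])) //.
exists (fun t => (thead t, [tuple of behead t])) => [[x t] _|t _] /=.
  by congr pair; apply: val_inj.
by rewrite -tuple_eta.
Qed.

(** When a tuple of length [p] is extended, at most [p] values of the new entry repeat an old one,
    and only these cost a factor [y]. *)
Lemma sum_defect_le (T : finType) p (y : R) : 0 <= y ->
  \sum_(t : p.-tuple T) y ^+ (p - rank t) <= \prod_(j < p) (#|T|%:R + j%:R * y).
Proof.
move=> y0; elim: p => [|p IH].
  by rewrite big_ord0 (eq_bigr (fun _ => 1)) ?sumr_const ?card_tuple ?expn0.
rewrite big_cons_tuple exchange_big big_ord_recr /= mulrC.
apply: le_trans (ler_wpM2l _ IH); last by rewrite addr_ge0 ?mulr_ge0.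
rewrite mulr_sumr; apply: ler_sum => t _.
rewrite (eq_bigr (fun x => y ^+ (p - rank t) * y ^+ (x \in t))); last first.
  move=> x _; rewrite rank_cons -exprD; congr (_ ^+ _).
  by have := rank_le t; case: (x \in t) => /=; lia.
rewrite -mulr_sumr mulrC ler_wpM2r ?exprn_ge0 //.
apply: le_trans (_ : \sum_x (1 + (x \in t)%:R * y) <= _).
  apply: ler_sum => x _; case: (x \in t); rewrite ?expr1 ?expr0 ?mul1r ?mul0r ?addr0 //.
  by rewrite lerDr.
rewrite big_split /= sumr_const lerD2l -mulr_suml ler_wpM2r //.
rewrite -natr_sum ler_nat -big_mkcond /= sum1_card.
by apply: leq_trans (card_size t) _; rewrite size_tuple.
Qed.

Let s : R := Num.sqrt 2.

Lemma sqrt2_sqr : s ^+ 2 = 2. Proof. by rewrite sqr_sqrtr. Qed.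
Lemma sqrt2_ge1 : 1 <= s.
Proof. by rewrite -[1]sqrtr1 ler_sqrt // ler1n. Qed.
Lemma sqrt2_gt0 : 0 < s. Proof. exact: lt_le_trans sqrt2_ge1. Qed.

Lemma sum_pos_defect_le (T : finType) (t K : nat) : (0 < t <= K)%N ->
  s ^+ (K + 12) <= #|T|%:R ->
  \sum_(a : 4.-tuple T | (0 < 4 - rank a)%N) (s ^+ (5 + t)) ^+ (4 - rank a)
   <= #|T|%:R ^+ 4 * s^-1 ^+ (K - t).
Proof.
move=> /andP[t0 tK]; set m : R := #|T|%:R; set y := s ^+ (5 + t) => hm.
have s0 := sqrt2_gt0; have s1 := sqrt2_ge1; have s2 := sqrt2_sqr.
have y8 : 8 <= y.
  rewrite /y (_ : 5 + t = 6 + t.-1)%N; last by move: t0; clear; lia.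
  rewrite exprD (exprM s 2 3) s2 -[leLHS]mulr1 ler_pM ?ler01 //; last exact: exprn_ege1.
  by rewrite -natrX ler_nat.
have y0 : 0 <= y by apply: le_trans y8; lra.
have m0 : 0 < m by apply: lt_le_trans hm; rewrite exprn_gt0.
set z := s^-1 ^+ (K - t).
have z0 : 0 <= z by rewrite exprn_ge0 // invr_ge0 ltW.
have z1 : z <= 1 by rewrite exprn_ile1 ?invr_ge0 ?invf_le1 // ltW.
(* The exponent [K + 12] is split as [7 + (5 + t) + (K - t)]: [5 + t] makes [y], [K - t] cancels
   [z], and [s ^+ 7 = 8 * s] is at least 11. *)
have ym : 11 * y <= z * m.
  apply: le_trans (_ : z * s ^+ (K + 12) <= _); last by rewrite ler_wpM2l.
  have -> : z * s ^+ (K + 12) = s ^+ 7 * y.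
    rewrite /z /y -exprD exprVn mulrC.
    rewrite (_ : K + 12 = 7 + (5 + t) + (K - t))%N; last by move: tK; clear; lia.
    by rewrite exprD mulfK // expf_neq0 // gt_eqF.
  rewrite ler_wpM2r // (exprD s 6 1) (exprM s 2 3) s2 expr1.
  have : 7 / 5 <= s by rewrite leNgt; apply/negP => h; move: s2; rewrite expr2 => s2; nra.
  lra.
(* y^e <= 8/7 (y^e - 1) for e > 0 turns the sum over all tuples into one over
   tuples with a repeated entry. *)
have total := sum_defect_le T 4 y0.
rewrite !big_ord_recl big_ord0 /= -/m in total.
have pointwise : \sum_(a : 4.-tuple T | (0 < 4 - rank a)%N) y ^+ (4 - rank a) <=
  8 / 7 * (\sum_(a : 4.-tuple T) y ^+ (4 - rank a) - m ^+ 4).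
  have -> : m ^+ 4 = \sum_(a : 4.-tuple T) 1 by rewrite sumr_const card_tuple natrX.
  rewrite -sumrB mulr_sumr [leLHS]big_mkcond; apply: ler_sum => a _.
  have y1 : 1 <= y by lra.
  case: (4 - rank a)%N => [|e] /=; first by rewrite subrr mulr0.
  have : 8 <= y ^+ e.+1 by apply: le_trans y8 _; rewrite exprS ler_peMr // exprn_ege1.
  lra.
apply: le_trans pointwise _.
rewrite -ler_pdivlMl //; last lra.
(* These are the terms of [m (m + y) (m + 2 y) (m + 3 y)] beyond [m ^+ 4]. *)
apply: le_trans (_ : 6 * y * m ^+ 3 + 11 * y ^+ 2 * m ^+ 2 + 6 * y ^+ 3 * m <= _).
  by move: total; rewrite /bump /=; lra.
have zm0 : 0 <= z * m by rewrite mulr_ge0 // ltW.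
have y2 : (11 * y) ^+ 2 <= z * m ^+ 2.
  apply: le_trans (_ : (z * m) ^+ 2 <= _); first by rewrite lerXn2r ?nnegrE // mulr_ge0.
  by rewrite exprMn ler_wpM2r ?sqr_ge0 // expr2 ler_piMr.
have y3 : (11 * y) ^+ 3 <= z * m ^+ 3.
  apply: le_trans (_ : (z * m) ^+ 3 <= _); first by rewrite lerXn2r ?nnegrE // mulr_ge0.
  by rewrite exprMn ler_wpM2r ?exprn_ge0 ?(ltW m0) // exprS ler_piMr // exprn_ile1.
have h1 : 11 * y * m ^+ 3 <= z * m * m ^+ 3 by rewrite ler_wpM2r // exprn_ge0 // ltW.
have h2 : (11 * y) ^+ 2 * m ^+ 2 <= z * m ^+ 2 * m ^+ 2 by rewrite ler_wpM2r // sqr_ge0.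
have h3 : (11 * y) ^+ 3 * m <= z * m ^+ 3 * m by rewrite ler_wpM2r // ltW.
have zm4 : 0 <= z * m ^+ 4 by rewrite mulr_ge0 // exprn_ge0 // ltW.
lra.
Qed.

Lemma square_le_exp2 j : (8 <= j)%N -> ((2 * j) ^ 2 <= 2 ^ j)%N.
Proof.
elim: j => // j IH; rewrite leq_eqVlt => /predU1P[<-//|j8].
have := IH j8; rewrite -!mulnn expnS; move: (2 ^ j)%N j8; clear; nia.
Qed.

Lemma leq_bin_expn K t : ('C(K, t) <= K ^ t)%N.
Proof.
rewrite -(leq_pmul2r (fact_gt0 t)) bin_ffact.
suff /leq_trans : (K ^_ t <= K ^ t)%N by apply; rewrite leq_pmulr ?fact_gt0.
by elim: t => // t IH; rewrite ffactnSr expnSr leq_mul // leq_subr.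
Qed.

(** By symmetry let [u <= v] be the two parts of [K]. Then ['C(u + v, u) <= (2 * v) ^ u], and
    [2 * v <= s ^+ v] because [16 <= K] forces [8 <= v]. *)
Lemma bin_le_sqrt2X K t : (16 <= K)%N -> (t <= K)%N ->
  'C(K, t)%:R * (s^-1 ^+ (K - t)) ^+ t <= 1.
Proof.
move=> K16 tK; have s0 := sqrt2_gt0.
suff key u v : (u <= v)%N -> (16 <= u + v)%N -> 'C(u + v, u)%:R <= s ^+ (u * v).
  rewrite -exprM exprVn ler_pdivrMr ?exprn_gt0 // mul1r.
  case: (leqP t (K - t)) => tKt; rewrite -{1}(subnK tK).
    by rewrite addnC mulnC key // subnKC.
  by rewrite -bin_sub ?leq_addl // addnK key ?subnK // ltnW.
move=> uv uv16; apply: le_trans (_ : (u + v)%:R ^+ u <= _).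
  by rewrite -natrX ler_nat leq_bin_expn.
rewrite mulnC exprM lerXn2r ?nnegrE ?exprn_ge0 ?(ltW s0) //.
rewrite -(ler_pXn2r (_ : 0 < 2)%N) ?nnegrE ?exprn_ge0 ?(ltW s0) //.
rewrite -exprM mulnC exprM sqrt2_sqr -!natrX ler_nat.
apply: leq_trans (square_le_exp2 (_ : 8 <= v)%N); last by move: uv uv16; clear; lia.
by rewrite leq_exp2r // mul2n -addnn leq_add2r.
Qed.

End Estimates.

(** * The fourth-moment bound at the start of the game *)

Section Bundles.
Variables (n k m : nat) (vert : 'I_k -> 'I_m -> 'I_n).
Hypothesis vert_lt : forall (i j : 'I_k) a b, i < j -> vert i a < vert j b.
Hypothesis vert_inj : forall i, injective (vert i).
Variable R : rcfType.
Local Open Scope ring_scope.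
Let s : R := Num.sqrt 2.
Hypothesis k_ge : (19 <= k)%N.
Hypothesis m_ge : s ^+ (k + 9) <= m%:R.

Notation quads := {ffun 'I_k -> 4.-tuple 'I_m}.
Notation defect t := (4 - rank t)%N.

Definition merged (Q : {set 'I_k}) (b : quads) : {set 'I_k} :=
  [set i in ~: Q | (0 < defect (b i))%N].

(** By [card_bundle] at most [N] edges are lost, [N] being the sum of the smaller defects, and
    [sum_minn_edges_le] bounds [2 * N]. The factor [s ^+ 18] accounts for the three pairs inside
    [Q]. *)
Lemma weight_bundle_le (Q : {set 'I_k}) (b : quads) : #|Q| = 3%N ->
  weight R set0 set0 (bundle vert b) <=
  2^-1 ^+ (4 * nedges k) * s ^+ 18 *
   \prod_(i in ~: Q) (s ^+ (5 + #|merged Q b|)) ^+ (defect (b i)).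
Proof.
move=> Q3; set D := merged Q b.
have s0 := sqrt2_gt0 R; have s1 := sqrt2_ge1 R; have s2 := sqrt2_sqr R.
have half0 : 0 <= 2^-1 :> R by rewrite invr_ge0.
rewrite prodrXr.
pose N := \sum_(p in edges k) minn (defect (b p.1)) (defect (b p.2)).
pose X := \sum_(p in edges k) maxn (rank (b p.1)) (rank (b p.2)).
have XN : (4 * nedges k = X + N)%N.
  rewrite -card_edges mulnC -sum_nat_const /X /N -big_split /=; apply: eq_bigr => p _.
  have := rank_le (b p.1); have := rank_le (b p.2); clear; lia.
have d3 i : (defect (b i) <= 3)%N by have := rank_gt0 (b i); lia.
have NX := sum_minn_edges_le Q3 d3; rewrite -/N in NX.
apply: le_trans (_ : 2^-1 ^+ X <= _).
  rewrite /weight setD0 -setI_eq0 setI0 eqxx mul1r.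
  by rewrite ler_wiXn2l ?invf_le1 ?ler1n // card_bundle.
have -> : 2^-1 ^+ X = 2^-1 ^+ (4 * nedges k) * s ^+ (2 * N) :> R.
  by rewrite XN exprD exprM s2 -mulrA -exprMn mulVf ?expr1n ?mulr1 // pnatr_eq0.
rewrite -mulrA ler_wpM2l ?exprn_ge0 //.
by rewrite -exprM -exprD ler_weXn2l.
Qed.

(** The sets [Z] of a given size contribute at most 1 together by [bin_le_sqrt2X], and there are
    [k - 2] sizes. *)
Lemma sum_subsets_le (Q : {set 'I_k}) : #|Q| = 3%N ->
  \sum_(Z : {set 'I_k} | Z \subset ~: Q) (s^-1 ^+ (#|~: Q| - #|Z|)) ^+ #|Z| <= k%:R.
Proof.
move=> Q3.
have KQ : (#|~: Q| + 3 = k)%N by rewrite -Q3 addnC cardsC card_ord.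
move KE : #|~: Q| KQ => K KQ.
rewrite (partition_big (fun Z : {set 'I_k} => inord #|Z| : 'I_K.+1) xpredT) //=.
apply: le_trans (_ : \sum_(t < K.+1) 1 <= _); last first.
  by rewrite sumr_const card_ord ler_nat; move: KQ; clear; lia.
apply: ler_sum => t _.
have tK : (t <= K)%N by rewrite -ltnS.
apply: le_trans (bin_le_sqrt2X R _ tK); last by move: KQ k_ge; clear; lia.
rewrite -[X in 'C(X, _)]KE -cards_draws -sum1_card natr_sum mulr_suml.
rewrite le_eqVlt; apply/orP; left; apply/eqP.
rewrite (eq_bigl (fun Z => Z \in [set A : {set 'I_k} | A \subset ~: Q & #|A| == t])); last first.
  move=> Z; rewrite inE; case: (boolP (Z \subset ~: Q)) => //= ZQ.
  by rewrite -val_eqE /= inordK // ltnS -KE subset_leq_card.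
by apply: eq_bigr => Z; rewrite inE => /andP[_ /eqP->]; rewrite mul1r.
Qed.

(** Constraint and summand factor over the parts: a part in [Q] gives at most [m], an unmerged part
    outside [Q] at most [m ^ 4], a merged one the bound of [sum_pos_defect_le]. The exponent is
    [3 + 4 * (k - 3)]. *)
Lemma sum_merged_le (Q Z : {set 'I_k}) : #|Q| = 3%N -> Z \subset ~: Q ->
  \sum_(b : quads | [forall i in Q, rank (b i) == 1%N] && (merged Q b == Z))
    \prod_(i in ~: Q) (s ^+ (5 + #|Z|)) ^+ (defect (b i)) <=
  m%:R ^+ (4 * k - 9) * (s^-1 ^+ (#|~: Q| - #|Z|)) ^+ #|Z|.
Proof.
move=> Q3 ZQ; set y := s ^+ (5 + #|Z|); set z := s^-1 ^+ _.
have s0 := sqrt2_gt0 R; have s1 := sqrt2_ge1 R; have s2 := sqrt2_sqr R.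
have y0 : 0 <= y by rewrite exprn_ge0 // ltW.
have KQ : (#|~: Q| + 3 = k)%N by rewrite -Q3 addnC cardsC card_ord.
pose cond (i : 'I_k) (a : 4.-tuple 'I_m) :=
  if i \in Q then rank a == 1%N else (0 < defect a)%N == (i \in Z).
pose H (i : 'I_k) (a : 4.-tuple 'I_m) := if i \in Q then 1 else y ^+ defect a.
have -> : \sum_(b : quads | [forall i in Q, rank (b i) == 1%N] && (merged Q b == Z))
    \prod_(i in ~: Q) y ^+ (defect (b i)) =
    \sum_(b in family cond) \prod_i H i (b i).
  apply: eq_big => [b|b _]; last first.
    by rewrite big_mkcond /=; apply: eq_bigr => i _; rewrite inE /H; case: (i \in Q).
  apply/andP/familyP => [[/forall_inP bQ /eqP bZ] i|bc].
    rewrite unfold_in /cond; case: ifPn => iQ; first exact: bQ.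
    by rewrite -bZ !inE iQ.
  split; first by apply/forall_inP => i iQ; have := bc i; rewrite unfold_in /cond iQ.
  apply/eqP/setP => i; have := bc i; rewrite [_ \in cond i]unfold_in /cond !inE.
  case: (boolP (i \in Q)) => [iQ _|iQ /eqP->] //=.
  by apply/esym/negbTE; apply: contraL iQ => /(subsetP ZQ); rewrite inE.
rewrite -bigA_distr_big_dep.
have -> : m%:R ^+ (4 * k - 9) * z ^+ #|Z| =
    \prod_(i < k) (if i \in Q then m%:R else m%:R ^+ 4 * (if i \in Z then z else 1)) :> R.
  rewrite (bigID (mem Q)) /= (eq_bigr (fun _ => m%:R)); last by move=> i ->.
  rewrite prodr_const Q3.
  rewrite (eq_bigr (fun i => m%:R ^+ 4 * (if i \in Z then z else 1))); last by move=> i /negPf->.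
  rewrite big_split /= -big_mkcondr /=.
  have -> : \prod_(i < k | (i \notin Q) && (i \in Z)) z = z ^+ #|Z|.
    rewrite -prodr_const; apply: eq_bigl => i.
    by case: (boolP (i \in Z)) => [/(subsetP ZQ)|]; rewrite ?andbF // inE andbT.
  have -> : \prod_(i < k | i \notin Q) m%:R ^+ 4 = (m%:R ^+ 4) ^+ #|~: Q| :> R.
    by rewrite -prodr_const; apply: eq_bigl => i; rewrite inE.
  rewrite mulrA -exprM -exprD; congr (_ ^+ _ * _); move: KQ; clear; lia.
apply: ler_prod => i _; rewrite /cond /H; case: (boolP (i \in Q)) => iQ.
  rewrite sumr_ge0 //= sumr_const ler_nat.
  by apply: leq_trans (card_rank1 _ _) _; rewrite card_ord.
rewrite sumr_ge0 /=; last by move=> a _; rewrite exprn_ge0.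
case: (boolP (i \in Z)) => iZ; last first.
  rewrite mulr1 (eq_bigr (fun _ => 1)); last first.
    by move=> a; rewrite eqbF_neg lt0n negbK => /eqP->.
  rewrite sumr_const -natrX ler_nat.
  by apply: leq_trans (max_card _) _; rewrite card_tuple card_ord.
rewrite (eq_bigl (fun a => 0 < defect a)%N); last by move=> a; rewrite eqb_id.
have := @sum_pos_defect_le R 'I_m #|Z| #|~: Q|; rewrite card_ord; apply.
  by rewrite (subset_leq_card ZQ) andbT card_gt0; apply/set0Pn; exists i.
by rewrite (_ : #|~: Q| + 12 = k + 9)%N //; move: KQ; clear; lia.
Qed.

(** There are at most [k ^ 3] sets [Q], and the sum over merged sets costs one more factor [k]. *)
Lemma potential_bundle_le :
  potential R (bundle_of vert) set0 set0 <=
  2^-1 ^+ (4 * nedges k) * 2 ^+ 9 * m%:R ^+ (4 * k - 9) * k%:R ^+ 4.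
Proof.
have s0 := sqrt2_gt0 R; have s1 := sqrt2_ge1 R; have s2 := sqrt2_sqr R.
have s18 : s ^+ 18 = 2 ^+ 9 by rewrite (exprM s 2 9) s2.
have c0 : 0 <= 2^-1 ^+ (4 * nedges k) * 2 ^+ 9 :> R by rewrite mulr_ge0 ?exprn_ge0 ?invr_ge0.
rewrite potential_bundle.
apply: le_trans (_ : \sum_(Q : {set 'I_k} | #|Q| == 3%N)
   2^-1 ^+ (4 * nedges k) * 2 ^+ 9 * m%:R ^+ (4 * k - 9) * k%:R <= _); last first.
  rewrite sumr_const -[X in X <= _]mulr_natr -mulrA ler_wpM2l ?mulr_ge0 ?exprn_ge0 ?invr_ge0 //.
  rewrite exprS ler_wpM2l // -natrX ler_nat; apply: leq_trans (leq_bin_expn k 3).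
  rewrite -[X in 'C(X, _)](card_ord k) -card_draws.
  by apply/eq_leq/eq_card => Q; rewrite inE.
apply: ler_sum => Q /eqP Q3.
rewrite (partition_big (merged Q) (fun Z => Z \subset ~: Q)) /=; last first.
  by move=> b _; apply/subsetP => i; rewrite inE => /andP[].
apply: le_trans (_ : \sum_(Z : {set 'I_k} | Z \subset ~: Q)
  2^-1 ^+ (4 * nedges k) * 2 ^+ 9 *
    (m%:R ^+ (4 * k - 9) * (s^-1 ^+ (#|~: Q| - #|Z|)) ^+ #|Z|) <= _); last first.
  rewrite -mulr_sumr -mulr_sumr mulrA; apply: ler_wpM2l; last exact: sum_subsets_le.
  by apply: mulr_ge0 => //; rewrite exprn_ge0.
apply: ler_sum => Z ZQ.
apply: le_trans (ler_wpM2l c0 (sum_merged_le Q3 ZQ)).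
rewrite mulr_sumr; apply: ler_sum => b /andP[_ /eqP bZ].
by rewrite -bZ -s18; exact: weight_bundle_le.
Qed.

Lemma potential_clique :
  potential R (clique vert) set0 set0 = m%:R ^+ k * 2^-1 ^+ nedges k.
Proof.
rewrite /potential (eq_bigr (fun _ => 2^-1 ^+ nedges k)); last first.
  by move=> f _; rewrite /weight setD0 card_clique // -setI_eq0 setI0 eqxx mul1r.
by rewrite sumr_const card_ffun !card_ord -[LHS]mulr_natl natrX.
Qed.

(** After taking fourth powers the powers of two from the edges cancel and nine powers of [m] remain
    to be compared. The factor [n ^+ 2] majorizes [4 / 3 * (nedges n).+1]. *)
Lemma initial_ratio_le : (2 ^ 9 * k ^ 4 * n ^ 8 <= m ^ 9)%N ->
  n%:R ^+ 2 * root4 (potential R (bundle_of vert) set0 set0) <=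
  potential R (clique vert) set0 set0.
Proof.
move=> hm; rewrite -(ler_pXn2r (_ : 0 < 4)%N) ?nnegrE ?potential_ge0 //; last first.
  by rewrite mulr_ge0 ?exprn_ge0 // root4_ge0.
rewrite exprMn root4K ?potential_ge0 //.
apply: le_trans (ler_wpM2l _ potential_bundle_le) _; first by rewrite !exprn_ge0.
rewrite [leRHS](_ : _ = 2^-1 ^+ (4 * nedges k) * (m ^ (k * 4))%:R); last first.
  by rewrite potential_clique [LHS]exprMn -[in LHS]exprM -[in LHS]exprM mulrC natrX (mulnC 4).
rewrite [leLHS](_ : _ = 2^-1 ^+ (4 * nedges k) *
   ((2 ^ 9 * k ^ 4 * n ^ 8 * m ^ (4 * k - 9))%N)%:R); last first.
  rewrite !natrM !natrX; ring.
rewrite ler_wpM2l ?exprn_ge0 ?invr_ge0 // ler_nat.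
rewrite (_ : k * 4 = 9 + (4 * k - 9))%N; last by move: k_ge; clear; lia.
by rewrite expnD leq_mul2r hm orbT.
Qed.

End Bundles.

(** * From a claimed clique to a copy of the tournament *)

Lemma maker_wins_large (R : rcfType) (n k m : nat) (T : rel 'I_k) :
  19 <= k -> k * m <= n -> (Num.sqrt 2 ^+ (k + 9) <= m%:R :> R)%R ->
  2 ^ 9 * k ^ 4 * n ^ 8 <= m ^ 9 -> is_tournament T -> maker_wins n T.
Proof.
move=> k_ge kmn m_ge km9 [Tirr Tasym].
have m0 : 0 < m.
  rewrite -(ltr0n R); apply: lt_le_trans m_ge; rewrite exprn_gt0 //.
  exact: sqrt2_gt0.
have n19 : 19 <= n by apply: leq_trans k_ge _; apply: leq_trans kmn; rewrite leq_pmulr.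
have vert_bound (i : 'I_k) (a : 'I_m) : i * m + a < n.
  apply: leq_trans kmn; apply: leq_trans (_ : i.+1 * m <= _).
    by rewrite mulSn addnC ltn_add2r.
  by rewrite leq_mul2r ltn_ord orbT.
pose vert (i : 'I_k) (a : 'I_m) : 'I_n := Ordinal (vert_bound i a).
have vert_lt (i j : 'I_k) a b : i < j -> vert i a < vert j b.
  move=> ij /=; apply: leq_trans (_ : i.+1 * m <= _).
    by rewrite mulSn addnC ltn_add2r.
  by apply: leq_trans (leq_addr _ _); rewrite leq_mul2r ij orbT.
have vert_inj i : injective (vert i).
  by move=> a b /(congr1 val)/addnI/val_inj.
(* An edge between two parts is kept increasing when [T] points from the lower part to the higher,
   and reversed otherwise. Edges inside a part or at leftover vertices are reversed too. *)
pose along (e : move n) := [exists p : move k, T p.1 p.2 &&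
  [exists a, exists b, e == edge_between vert p a b]].
pose orient (e : move n) : move n := if along e then e else (e.2, e.1).
have orientK e : e \in edges n -> edge_of (orient e) = e.
  rewrite inE /orient /edge_of; case: e => u v /= uv.
  by case: (along _) => /=; rewrite ?uv // ltnNge (ltnW uv).
have ratio : (4 / 3 * (nedges n).+1%:R *
    root4 (potential R (bundle_of vert) set0 set0) <= potential R (clique vert) set0 set0)%R.
  apply: le_trans (initial_ratio_le vert_lt vert_inj k_ge m_ge km9).
  rewrite ler_wpM2r ?root4_ge0 //.
  have : ((nedges n).+1 * 4 <= n ^ 2 * 3)%N.
    rewrite /nedges bin2 -mulnn; have := half_leq (leqnn (n * n.-1)).
    have := leq_half_double; have := odd_double_half (n * n.-1); nia.
  by rewrite -(ler_nat R) natrM [X in (_ <= X)%R -> _]natrM natrX; lra.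
have clique_gt1 f : 1 < #|clique vert f|.
  rewrite card_clique // /nedges; apply: leq_trans (_ : 'C(3, 2) <= _) => //.
  by apply: leq_bin2l; apply: leq_trans k_ge.
have T0 : (0 < potential R (clique vert) set0 set0)%R.
  apply/potential_gt0P; exists [ffun=> Ordinal m0]; by rewrite -setI_eq0 setI0.
pose o0 : 'I_n := Ordinal (leq_trans (isT : 0 < 19) n19).
exists (greedy R (clique vert) (bundle_of vert) orient (o0, o0)) => sB.
have [[leg [f fM]]|[t [tn todd it leg]]] := greedy_wins (clique_edges vert_lt) clique_gt1
   (codegree_clique_le vert_lt vert_inj R) T0 ratio orientK (o0, o0) sB;
  last by right; exists t.
left; split => //; exists (fun i => vert i (f i)); split.
  by move=> i j /eqP; rewrite vert_eq // => /andP[/eqP].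
have orient_between (p : move k) : orient (edge_between vert p (f p.1) (f p.2)) =
    if T p.1 p.2 then edge_between vert p (f p.1) (f p.2)
    else (vert p.2 (f p.2), vert p.1 (f p.1)).
  rewrite /orient; congr (if _ then _ else _).
  apply/existsP/idP => [[q /andP[Tq /existsP[a /existsP[b]]]]|Tp].
    by rewrite edge_between_eq // => /and3P[/eqP->].
  by exists p; rewrite Tp; apply/existsP; exists (f p.1); apply/existsP; exists (f p.2).
have in_clique (p : move k) : p.1 < p.2 -> edge_between vert p (f p.1) (f p.2) \in clique vert f.
  by move=> pE; rewrite mem_clique ?eqxx // inE.
move=> i j Tij; case: (ltngtP i j) => [ij|ji|/val_inj ij].
- by have := fM _ (in_clique (i, j) ij); rewrite orient_between /= Tij.
- have := fM _ (in_clique (j, i) ji); rewrite orient_between /=.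
  have /Tasym : i != j by rewrite -val_eqE gtn_eqF.
  by rewrite Tij; case: (T j i).
- by have := Tirr i; rewrite {2}ij Tij.
Qed.

(** The 24th power of [4 * k <= 2 ^ q] for [q = k %/ 24]; that inequality is available from
    [q = 12], hence from [k = 288]. *)
Lemma pow24_le_exp2 k : 288 <= k -> 2 ^ 25 * k ^ 24 <= 2 ^ k.
Proof.
move=> k288; set q := k %/ 24.
have q12 : 12 <= q by rewrite leq_divRL.
have kq : k < 24 * q.+1 by rewrite mulnC -ltn_divLR.
have : 4 * k <= 2 ^ q.
  apply: (@leq_trans (96 * q.+1)); first by move: kq; clear; lia.
  move: (q) q12; clear; elim => // q IH; rewrite leq_eqVlt => /predU1P[<-//|q12].
  by have := IH q12; rewrite expnS; lia.
rewrite -(@leq_exp2r _ _ 24) // -expnM expnMn => h.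
apply: leq_trans (_ : 2 ^ (q * 24) <= _); last by rewrite leq_exp2l // leq_divM.
apply: leq_trans h; rewrite leq_mul2r; apply/orP; right.
by rewrite -[4]/(2 ^ 2) -expnM leq_exp2l.
Qed.

(** Rounding [n / k] down costs at most a factor 2 in the square. Since [n <= 2 * (m * k)], the
    second bound reduces to [2 ^ 17 * k ^ 12 <= m], and, squared, to [pow24_le_exp2]. *)
Lemma parts_size_bounds n k : 288 <= k -> 2 ^ (k + 10) * k ^ 2 <= n ^ 2 ->
  2 ^ (k + 9) <= (n %/ k) ^ 2 /\ 2 ^ 9 * k ^ 4 * n ^ 8 <= (n %/ k) ^ 9.
Proof.
move=> k288 kn; set m := n %/ k.
have k0 : 0 < k by apply: leq_trans k288.
have nm : n < m.+1 * k by rewrite -ltn_divLR.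
have m1 : 2 ^ (k + 10) < m.+1 ^ 2.
  rewrite -(ltn_pmul2r (_ : 0 < k ^ 2)) ?expn_gt0 ?k0 //.
  by apply: leq_ltn_trans kn _; rewrite -expnMn ltn_exp2r.
have m31 : 31 < m.
  rewrite -ltnS -(ltn_exp2r _ _ (_ : 0 < 2)) //; apply: leq_ltn_trans m1.
  by rewrite (_ : 32 ^ 2 = 2 ^ 10) // leq_exp2l // leq_addl.
have m2 : 2 ^ (k + 9) <= m ^ 2.
  rewrite -(leq_pmul2l (_ : 0 < 2)) // -expnS -addnS.
  by apply: leq_trans (ltnW m1) _; rewrite -!mulnn; move: m31; clear; nia.
split => //.
have mk : 2 ^ 17 * k ^ 12 <= m.
  rewrite -(leq_exp2r _ _ (_ : 0 < 2)) //; apply: leq_trans m2.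
  rewrite expnMn -!expnM (addnC k) expnD -[17 * 2]/(9 + 25) expnD -[12 * 2]/24.
  by rewrite -mulnA leq_mul2l pow24_le_exp2 // orbT.
have n2 : n <= 2 * (m * k).
  apply: leq_trans (ltnW nm) _; rewrite mulnA leq_mul2r; apply/orP; right.
  by move: m31; clear; lia.
apply: (@leq_trans (2 ^ 9 * k ^ 4 * (2 * (m * k)) ^ 8)).
  by rewrite leq_mul2l leq_exp2r // n2 orbT.
rewrite (expnSr m 8); apply: (@leq_trans (m ^ 8 * (2 ^ 17 * k ^ 12))); last first.
  by rewrite leq_mul2l mk orbT.
apply: eq_leq; rewrite !expnMn (expnD 2 9 8) (expnD k 4 8).
move: (2 ^ 9) (2 ^ 8) (k ^ 4) (k ^ 8) (m ^ 8) => a b c d e.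
by rewrite !mulnA [e * a]mulnC -!mulnA; congr (a * _); lia.
Qed.

(** * The size of the parts *)

Section Logarithms.
Local Open Scope R_scope.

Lemma INR_expn a b : INR (a ^ b)%N = INR a ^ b.
Proof. by elim: b => // b IH; rewrite expnS -multE mult_INR IH. Qed.

Lemma ln_le_sub1 x : 0 < x -> ln x <= x - 1.
Proof. move=> x0; have := exp_ineq1_le (ln x); rewrite exp_ln //; Lra.lra. Qed.

(** With [L] and [M] the first and second iterated logarithms of [n], [k + 12 <= 2 * L - 2 * M] says
    [2 ^ (k + 12) * L ^ 2 <= n ^ 2], and [k <= 2 * L] replaces [L ^ 2] by [k ^ 2 / 4]. *)
Lemma log2R_bounds (n k : nat) : exp 1000 < INR n ->
  INR k <= 2 * log2R (INR n) - 2 * log2R (log2R (INR n)) - 12 ->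
  2 * log2R (INR n) - 2 * log2R (log2R (INR n)) - 12 < INR k + 1 ->
  (288 <= k)%N /\ (2 ^ (k + 10) * k ^ 2 <= n ^ 2)%N.
Proof.
move=> exp_n k_le k_gt.
have n0 : 0 < INR n by have := exp_pos 1000; Lra.lra.
have ln_n : 1000 < ln (INR n).
  by rewrite -[X in X < _]ln_exp; apply: ln_increasing => //; exact: exp_pos.
have l2 := ln_lt_2.
have l2' : ln 2 < 1.
  by rewrite -[X in _ < X]ln_exp; apply: ln_increasing; have := exp_ineq1 1; Lra.lra.
set L := log2R (INR n) in k_le k_gt.
have Lln : L * ln 2 = ln (INR n) by rewrite /L /log2R /Rdiv Rmult_assoc Rinv_l; Lra.lra.
clearbody L.
have L1000 : 1000 < L by apply: Rnot_le_lt => L1000; have := Rmult_le_compat_r (ln 2) _ _ ltac:(Lra.lra) L1000; Lra.lra.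
have L0 : 0 < L by Lra.lra.
set M := log2R L in k_le k_gt.
have Mln : M * ln 2 = ln L by rewrite /M /log2R /Rdiv Rmult_assoc Rinv_l; Lra.lra.
have M0 : 0 <= M.
  apply: Rnot_lt_le => M0; have : ln 1 < ln L by apply: ln_increasing; Lra.lra.
  rewrite ln_1 -Mln => h; have := Rmult_lt_compat_r (ln 2) _ _ ltac:(Lra.lra) M0; Lra.lra.
(* Taking the tangent bound at [L / 4] leaves a slope small enough for [M <= 2 + L / 2], hence
   [k > L - 17]. *)
have lnL : ln L <= 2 * ln 2 + (L / 4 - 1).
  rewrite -[X in ln X](_ : 2 * 2 * (L / 4) = L); last Lra.lra.
  rewrite (ln_mult (2 * 2) (L / 4)) ?(ln_mult 2 2); try Lra.lra.
  have := ln_le_sub1 (x := L / 4) ltac:(Lra.lra); Lra.lra.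
have M_le : M <= 2 + L / 2.
  apply: Rnot_lt_le => M1; have := Rmult_lt_compat_r (ln 2) _ _ ltac:(Lra.lra) M1.
  have := Rmult_lt_compat_r (L / 2) _ _ ltac:(Lra.lra) l2; Lra.lra.
have k2L : INR k <= 2 * L by Lra.lra.
split.
  apply/ssrnat.leP/INR_le; rewrite [INR 288]INR_IZR_INZ /=; Lra.lra.
apply/ssrnat.leP/INR_le; rewrite -multE mult_INR !INR_expn [INR 2]INR_IZR_INZ /=.
have e1 : 2 ^ (k + 12) * L ^ 2 <= INR n ^ 2.
  have p2 : 0 < 2 ^ (k + 12) by apply: pow_lt; Lra.lra.
  have q2 : 0 < L ^ 2 by apply: pow_lt.
  apply: Rnot_lt_le => /(ln_increasing _ _ (pow_lt _ 2 n0)).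
  rewrite ln_mult // !ln_pow //; last Lra.lra.
  rewrite -Lln -Mln -plusE plus_INR [INR 12]INR_IZR_INZ [INR 2]INR_IZR_INZ /=.
  have := Rmult_le_compat_r (ln 2) _ _ ltac:(Lra.lra) k_le; Lra.lra.
have k0 := pos_INR k.
have e2 : INR k ^ 2 <= 4 * L ^ 2.
  have := Rmult_le_compat _ _ _ _ k0 k0 k2L k2L; Lra.lra.
have p10 : 0 < 2 ^ (k + 10) by apply: pow_lt; Lra.lra.
have e12 : 2 ^ (k + 12) = 4 * 2 ^ (k + 10) by rewrite !addnS /=; Lra.lra.
have := Rmult_le_compat_l _ _ _ (Rlt_le _ _ p10) e2; move: e1; rewrite e12 /=; Lra.lra.
Qed.

End Logarithms.

Theorem theorem2 :
  exists N : nat, forall n : nat, N <= n ->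
    forall k : nat,
      Rle (INR k)
          (Rminus (Rminus (Rmult (IZR 2%Z) (log2R (INR n)))
                          (Rmult (IZR 2%Z) (log2R (log2R (INR n)))))
                  (IZR 12%Z)) ->
      Rlt (Rminus (Rminus (Rmult (IZR 2%Z) (log2R (INR n)))
                          (Rmult (IZR 2%Z) (log2R (log2R (INR n)))))
                  (IZR 12%Z))
          (Rplus (INR k) (IZR 1%Z)) ->
      forall T : rel 'I_k, is_tournament T -> maker_wins n T.
Proof.
(* This makes the binary logarithm of [n] exceed 1000, ample for [288 <= k]. *)
have [N hN] := INR_unbounded (exp 1000).
exists N => n Nn k k_le k_gt T Ttour.
have exp_n : Rlt (exp 1000) (INR n).
  by apply: Rlt_le_trans hN _; apply/le_INR/ssrnat.leP.
have [k288 kn] := log2R_bounds exp_n k_le k_gt.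
have [km2 km9] := parts_size_bounds k288 kn.
apply: (@maker_wins_large Rdefinitions.R n k (n %/ k)) => //.
- exact: leq_trans k288.
- by rewrite mulnC leq_divM.
- rewrite -(ler_pXn2r (_ : 0 < 2)%N) ?nnegrE ?exprn_ge0 ?sqrtr_ge0 //.
  by rewrite -exprM mulnC exprM sqr_sqrtr // -!natrX ler_nat.
Qed.
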